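(* There exists a semigroup $U$ with an ideal $I$, and an ideal $N$ of (the semigroup) $I$, such that $U$, $N$ and the Rees quotient $I/N$ satisfy $M_J$ but $I$ does not satisfy $M_J$.
   Context: For a semigroup $S$, $S^1$ denotes the monoid obtained from $S$ by adjoining a new identity $1$. Green's $\mathcal J$-preorder on $S$ is $a\leq_{\mathcal J}b\Leftrightarrow S^1aS^1\subseteq S^1bS^1$; it induces an equivalence relation $\mathcal J$ and a partial order on the set of $\mathcal J$-classes. A semigroup satisfies $M_J$ if every non-empty set of its $\mathcal J$-classes contains a minimal member. An ideal of $S$ is a subset $I$ with $SI\subseteq I$ and $IS\subseteq I$; ideals are regarded as semigroups in their own right when saying they satisfy $M_J$. The Rees quotient $S/I$ is the semigroup with underlying set $(S\setminus I)\sqcup\{0\}$ and multiplication $a\cdot b=ab$ if $a,b,ab\in S\setminus I$, and $a\cdot b=0$ otherwise. *)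

(* Defs.v *)
From HB Require Import structures.
From mathcomp Require Import all_boot.
From mathcomp Require Import boolp classical_sets.

Set Implicit Arguments.
Unset Strict Implicit.
Unset Printing Implicit Defensive.

Local Open Scope classical_set_scope.
Local Open Scope group_scope.

(* S^1: [None] is the new identity, adjoined even if S already has one. *)
Definition adjoin_one (S : Type) : Type := option S.

HB.instance Definition _ (S : choiceType) := Choice.copy (adjoin_one S) (option S).

Section AdjoinOne.
Variable S : semigroupType.

Definition adjoin_mul (x y : adjoin_one S) : adjoin_one S :=
  match x, y with
  | Some a, Some b => Some (a * b)
  | None, _ => y
  | _, None => x
  end.

Fact adjoin_mulA : associative adjoin_mul.
Proof. by case=> [a|] [b|] [c|] //=; rewrite mulgA. Qed.

Fact adjoin_mul_1l : left_id None adjoin_mul.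
Proof. by case. Qed.

Fact adjoin_mul_1r : right_id None adjoin_mul.
Proof. by case. Qed.

HB.instance Definition _ :=
  isMonoid.Build (adjoin_one S) adjoin_mulA adjoin_mul_1l adjoin_mul_1r.

End AdjoinOne.

Section Green.
Variable S : semigroupType.

Definition principal_ideal (a : S) : set (adjoin_one S) :=
  [set x * (Some a : adjoin_one S) * y | x in setT & y in setT].

Definition J_le (a b : S) : Prop := principal_ideal a `<=` principal_ideal b.

Definition J_eq (a b : S) : Prop := J_le a b /\ J_le b a.

Definition J_class (a : S) : set S := [set b | J_eq a b].

Definition J_class_le (C D : set S) : Prop :=
  exists a b : S, [/\ C a, D b & J_le a b].

Definition satisfies_MJ : Prop :=
  forall X : set (set S), X `<=` range J_class -> X !=set0 ->
    exists2 C, X C & forall D, X D -> J_class_le D C -> D = C.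

Definition ideal (I : set S) : Prop :=
  forall s x : S, I x -> I (s * x) /\ I (x * s).

End Green.

Arguments satisfies_MJ S : clear implicits.

(* The proof argument of the next two types serves only to carry the
   hypothesis under which they are semigroups. *)
Definition ideal_semigroup (S : semigroupType) (I : set S) (_ : ideal I) : Type :=
  set_type I.

Section IdealSemigroup.
Variables (S : semigroupType) (I : set S) (HI : ideal I).

HB.instance Definition _ := SubChoice.copy (ideal_semigroup HI) (set_type I).

Fact ideal_mulg_closed : mulg_closed (mem I).
Proof.
by move=> u v uI vI; apply/mem_set; apply: (HI u _).1; apply: set_mem.
Qed.

HB.instance Definition _ :=
  SubChoice_isSubSemigroup.Build S (mem I) (ideal_semigroup HI) ideal_mulg_closed.

End IdealSemigroup.

(* [None] is the zero of the Rees quotient. *)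
Definition rees_quotient (S : semigroupType) (I : set S) (_ : ideal I) : Type :=
  option (set_type (~` I)).

Section ReesQuotient.
Variables (S : semigroupType) (I : set S) (HI : ideal I).

HB.instance Definition _ :=
  Choice.copy (rees_quotient HI) (option (set_type (~` I))).

(* [insub c] is [Some c] if c lies outside I and [None] otherwise. *)
Definition rees_mul (x y : rees_quotient HI) : rees_quotient HI :=
  match x, y with
  | Some a, Some b => insub (val a * val b)
  | _, _ => None
  end.

Fact rees_mulA : associative rees_mul.
Proof.
case=> [a|] [b|] [c|] //=; last by case: insubP.
case: (insubP _ (sval a * sval b)) => [u _ uE|/negP abI];
  case: (insubP _ (sval b * sval c)) => [v _ vE|/negP bcI] //=.
- by rewrite [sval u]uE [sval v]vE mulgA.
- rewrite [sval u]uE -mulgA insubN //; apply/negP => /set_mem; apply.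
  by apply: (HI _ _).1; apply: contrapT => /mem_set.
- rewrite [sval v]vE mulgA insubN //; apply/negP => /set_mem; apply.
  by apply: (HI _ _).2; apply: contrapT => /mem_set.
Qed.

HB.instance Definition _ := isSemigroup.Build (rees_quotient HI) rees_mulA.

End ReesQuotient.

(* Main.v *)
Require Import Defs.
From HB Require Import structures.
From mathcomp Require Import all_boot.
From mathcomp Require Import boolp classical_sets.
From mathcomp Require Import zify.

(**
  Let B be the bicyclic monoid and let U consist of the upper triangular 2x2
  matrix units with entries in B, together with 0.  Since B is simple, the
  J-classes of U are E11 B, E12 B, E22 B and {0}.  In the ideal
  I = E11 B + E12 B + {0} the entries in position (1,2) are multiplied
  nontrivially only from the left, so the J-order on them is the L-preorder of
  B, which has infinite descending chains.  Yet N = E12 B + {0} is null and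
  I/N is B with a zero adjoined.
*)

Set Implicit Arguments.
Unset Strict Implicit.
Unset Printing Implicit Defensive.

Local Open Scope classical_set_scope.
Local Open Scope group_scope.

(** * The J-preorder and sufficient criteria for M_J *)

Section JOrder.
Variable S : semigroupType.
Implicit Types a b c : S.

Lemma J_leP a b :
  J_le a b <-> exists x y : adjoin_one S, x * (Some b : adjoin_one S) * y = Some a.
Proof.
split=> [/(_ (Some a)) []|[x [y xby]] _ [u _ [v _ <-]]].
- by exists 1 => //; exists 1 => //; rewrite mul1g mulg1.
- by move=> x _ [y _ xby]; exists x, y.
- exists (u * x) => //; exists (y * v) => //.
  by rewrite -xby !mulgA.
Qed.

Lemma J_le_refl a : J_le a a.
Proof. by []. Qed.

Lemma J_le_trans b a c : J_le a b -> J_le b c -> J_le a c.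
Proof. exact: subset_trans. Qed.

Lemma J_le_mul a x y : J_le (x * a * y) a.
Proof. by apply/J_leP; exists (Some x), (Some y). Qed.

Lemma J_le_mull a x : J_le (x * a) a.
Proof. by apply/J_leP; exists (Some x), None. Qed.

(** Used in contrapositive form: an ideal containing b but not a certifies that a is not below b. *)
Lemma ideal_J_le (K : set S) a b : ideal K -> J_le a b -> K b -> K a.
Proof.
move=> KI /J_leP[x [y xby]] Kb.
case: x y xby => [x|] [y|] [<-] //.
- exact: (KI y _ (KI x _ Kb).1).2.
- exact: (KI x _ Kb).1.
- exact: (KI y _ Kb).2.
Qed.

Lemma J_class_eq a b : J_eq a b -> J_class a = J_class b.
Proof.
move=> [ab ba]; apply/seteqP; split=> c [h k]; split.
- exact: J_le_trans ba h.
- exact: J_le_trans k ab.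
- exact: J_le_trans ab h.
- exact: J_le_trans k ba.
Qed.

Lemma J_class_leE a b : J_class_le (J_class a) (J_class b) -> J_le a b.
Proof.
move=> [a' [b' [[aa' _] [_ b'b] a'b']]].
exact: J_le_trans aa' (J_le_trans a'b' b'b).
Qed.

(** Among all elements whose class lies in X, one of least rank has a minimal class: whatever lies
    below it has at least its rank, so the hypothesis reverses the relation. *)
Lemma rank_satisfies_MJ (f : S -> nat) :
  (forall a b, J_le a b -> f b <= f a -> J_le b a) -> satisfies_MJ S.
Proof.
move=> fP X XJ [C0 XC0]; have [c0 _ c0E] := XJ _ XC0.
pose P n := `[< exists2 c, f c = n & X (J_class c) >].
have exP : exists n, P n.
  by exists (f c0); apply/asboolP; exists c0; rewrite ?c0E.
case: (ex_minnP exP) => n /asboolP [c <- Xc] cmin.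
exists (J_class c) => // D XD; have [d _ dE] := XJ _ XD; rewrite -dE in XD *.
move=> /J_class_leE dc; apply: J_class_eq; split=> //.
by apply: fP => //; apply: cmin; apply/asboolP; exists d.
Qed.

Lemma zero_simple_satisfies_MJ (z : S) :
  (forall a, z * a = z) -> (forall a b, a <> z -> b <> z -> J_le a b) ->
  satisfies_MJ S.
Proof.
move=> zS simS; apply: (@rank_satisfies_MJ (fun a => a != z)) => a b _.
case: (eqVneq b z) => [-> _|/eqP bz]; first by rewrite -(zS a); apply: J_le_mull.
by case: (eqVneq a z) => [//|/eqP az _]; apply: simS.
Qed.

(** Only b itself and z lie below b, so rank 0 for z and rank 1 for all other elements works. *)
Lemma null_satisfies_MJ (z : S) : (forall a b, a * b = z) -> satisfies_MJ S.
Proof.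
move=> nullS; apply: (@rank_satisfies_MJ (fun a => a != z)) => a b.
move=> /J_leP[x [y xby]].
have [->|->] : a = b \/ a = z; last first.
- by case: (eqVneq b z) => [-> _|_]; [apply: J_le_refl | rewrite eqxx].
- by move=> _; apply: J_le_refl.
by case: x y xby => [x|] [y|] /= [<-]; rewrite ?nullS; [right..|left].
Qed.

End JOrder.

(** * The bicyclic monoid and its simplicity *)

Definition bicyclic : Type := (nat * nat)%type.

HB.instance Definition _ := Choice.copy bicyclic (nat * nat)%type.

(* [(a, b)] stands for q^a p^b, where p q = 1. *)
Definition bicyclic_mul (x y : bicyclic) : bicyclic :=
  (x.1 + (y.1 - x.2), y.2 + (x.2 - y.1))%N.

Fact bicyclic_mulA : associative bicyclic_mul.
Proof. by move=> [a b] [c d] [e f]; congr pair => /=; lia. Qed.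

HB.instance Definition _ := isSemigroup.Build bicyclic bicyclic_mulA.

Lemma bicyclic_simple (a b : bicyclic) : exists x y : bicyclic, x * b * y = a.
Proof.
(* As p^n q^n = 1, the inner powers cancel in q^a1 p^b1 . q^b1 p^b2 . q^b2 p^a2. *)
exists (a.1, b.1), (b.2, a.2); case: a b => [a1 a2] [b1 b2].
by congr pair => /=; lia.
Qed.

(** * Triangular matrix units over a simple semigroup *)

Inductive triangular (T : Type) :=
  Zero | E11 of T | E12 of T | E22 of T.
Arguments Zero {T}.

HB.instance Definition _ (T : Type) := gen_eqMixin (triangular T).
HB.instance Definition _ (T : Type) := gen_choiceMixin (triangular T).

Section Triangular.
Variable T : semigroupType.

Definition triangular_mul (x y : triangular T) : triangular T :=
  match x, y with
  | E11 a, E11 b => E11 (a * b)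
  | E11 a, E12 b => E12 (a * b)
  | E12 a, E22 b => E12 (a * b)
  | E22 a, E22 b => E22 (a * b)
  | _, _ => Zero
  end.

Fact triangular_mulA : associative triangular_mul.
Proof. by case=> [|a|a|a] [|b|b|b] [|c|c|c] //=; rewrite mulgA. Qed.

HB.instance Definition _ := isSemigroup.Build (triangular T) triangular_mulA.

(* The ideal I of the header; [corner] below is N. *)
Definition top_row : set (triangular T) :=
  [set x | if x is E22 _ then False else True].

Fact top_row_ideal : ideal top_row.
Proof. by case=> [|a|a|a] [|b|b|b]. Qed.

Notation I := (ideal_semigroup top_row_ideal).

Definition corner : set I := [set x | if val x is E11 _ then False else True].

Fact corner_ideal : ideal corner.
Proof.
by move=> [s sI] [x xI]; rewrite /corner /=; case: s sI x xI => [|a|a|a] sI [|b|b|b].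
Qed.

Hypothesis simT : forall a b : T, exists x y : T, x * b * y = a.

Lemma J_le_E11 a b : J_le (E11 a) (E11 b).
Proof. by have [x [y <-]] := simT a b; apply: (@J_le_mul _ (E11 b) (E11 x) (E11 y)). Qed.

Lemma J_le_E12 a b : J_le (E12 a) (E12 b).
Proof. by have [x [y <-]] := simT a b; apply: (@J_le_mul _ (E12 b) (E11 x) (E22 y)). Qed.

Lemma J_le_E22 a b : J_le (E22 a) (E22 b).
Proof. by have [x [y <-]] := simT a b; apply: (@J_le_mul _ (E22 b) (E22 x) (E22 y)). Qed.

Lemma triangular_MJ : satisfies_MJ (triangular T).
Proof.
(* [E11] and [E22] entries are never comparable, so they can share the top rank. *)
pose f (x : triangular T) : nat :=
  match x with Zero => 0%N | E12 _ => 1%N | E11 _ | E22 _ => 2%N end.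
apply: (@rank_satisfies_MJ _ f).
move=> [|a|a|a] [|b|b|b]; rewrite /f //= => + _.
all: try by move=> _; do [exact: J_le_E11 | exact: J_le_E12 | exact: J_le_E22].
all: by move=> /J_leP[] [[|x|x|x]|] [] [[|y|y|y]|].
Qed.

Lemma corner_MJ : satisfies_MJ (ideal_semigroup corner_ideal).
Proof.
have zI : Zero \in top_row by apply/mem_set.
pose z : I := exist _ Zero zI.
have zN : z \in corner by apply/mem_set.
apply: (@null_satisfies_MJ _ (exist _ z zN : ideal_semigroup corner_ideal)).
move=> [[x xI] xN] [[y yI] yN]; apply/val_inj/val_inj => /=.
case: x xI xN => [|a|a|a] xI xN //; first by have := set_mem xN.
by case: y yI yN => [|b|b|b] yI yN //; have := set_mem yI.
by have := set_mem xI.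
Qed.

Lemma top_row_mod_corner_MJ : satisfies_MJ (rees_quotient corner_ideal).
Proof.
have E11I c : E11 c \in top_row by apply/mem_set.
have E11N c : (exist _ (E11 c) (E11I c) : I) \in ~` corner by apply/mem_set.
pose w c : set_type (~` corner) := exist (fun x => x \in ~` corner) _ (E11N c).
(* [e] is multiplicative and reaches every nonzero element, so simplicity of T makes all of these
   J-equivalent. *)
pose e c : rees_quotient corner_ideal := Some (w c).
have eM c d : e c * e d = e (c * d).
  transitivity (insub (val (w (c * d))) : rees_quotient corner_ideal).
    by congr insub; apply/val_inj.
  exact: valK.
have eP x : x <> None -> exists c, x = e c.
  case: x => [[[[|c|c|c] xI] xN]|//] _; do ?by case: (set_mem xN).
  by exists c; congr Some; do 2!apply/val_inj.
apply: (@zero_simple_satisfies_MJ _ (None : rees_quotient corner_ideal)) => //.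
move=> _ _ /eP[a ->] /eP[b ->]; have [x [y <-]] := simT a b.
by rewrite -!eM; apply: J_le_mul.
Qed.

End Triangular.

(** * An infinite strictly descending J-chain in I *)

Lemma bicyclic_top_row_not_MJ :
  ~ satisfies_MJ (ideal_semigroup (top_row_ideal (T := bicyclic))).
Proof.
have memI x : top_row x -> x \in @top_row bicyclic by apply: mem_set.
pose c n : ideal_semigroup (top_row_ideal (T := bicyclic)) :=
  exist _ (E12 (0, n) : triangular bicyclic) (memI (E12 (0, n)) Logic.I).
pose p : ideal_semigroup (top_row_ideal (T := bicyclic)) :=
  exist _ (E11 (0, 1%N) : triangular bicyclic) (memI (E11 (0, 1%N)) Logic.I).
have pc n : p * c n = c n.+1.
  by apply/val_inj; congr (E12 (_, _)) => /=; lia.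
(* Left multiplication in the bicyclic monoid never lowers the exponent of p, and right
   multiplication by elements of I sends every [E12] entry to [Zero]. So [K n] is an ideal, and
   [K n.+1] separates [c n] from [c n.+1]. *)
pose K n : set (ideal_semigroup (top_row_ideal (T := bicyclic))) :=
  [set x | match val x with Zero => True | E12 b => (n <= b.2)%N | _ => False end].
have KI n : ideal (K n).
  move=> [s sI] [x xI] Kx; rewrite /K /=.
  case: s sI x xI Kx => [|s|s|s] sI [|x|x|x] xI //; last by have := set_mem sI.
  by rewrite /K /=; lia.
have c_strict n : ~ J_le (c n) (c n.+1).
  by move=> /(ideal_J_le (KI n.+1)) /(_ (leqnn _)); rewrite /K /= ltnn.
move=> MJ; have [||_ [n _ <-] cmin] := MJ (range (fun n => J_class (c n))).
- by move=> _ [n _ <-]; exists (c n).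
- by exists (J_class (c 0)), 0.
(* Minimality of the class of [c n] forces it to equal that of [c n.+1], since [c n.+1] is the left
   multiple [p * c n]. *)
apply: (c_strict n).
have : J_class (c n) (c n) by split; apply: J_le_refl.
rewrite -(cmin (J_class (c n.+1))) => [[]//| |]; first by exists n.+1.
exists (c n.+1), (c n).
by split; [split | split |]; rewrite -?pc; do ?exact: J_le_refl; apply: J_le_mull.
Qed.

Theorem corollary4p19 :
  exists (U : semigroupType) (I : set U) (HI : ideal I)
         (N : set (ideal_semigroup HI)) (HN : ideal N),
    [/\ satisfies_MJ U,
        satisfies_MJ (ideal_semigroup HN),
        satisfies_MJ (rees_quotient HN)
      & ~ satisfies_MJ (ideal_semigroup HI)].
Proof.
exists (triangular bicyclic), (@top_row bicyclic), (@top_row_ideal bicyclic).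
exists (@corner bicyclic), (@corner_ideal bicyclic); split.
- exact/triangular_MJ/bicyclic_simple.
- exact: corner_MJ.
- exact/top_row_mod_corner_MJ/bicyclic_simple.
- exact: bicyclic_top_row_not_MJ.
Qed.
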